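(* Consider the control affine system $\dot x = f(x)+g(x)u$ with $x\in\mathbb{R}^n$, $u\in U\subset\mathbb{R}^m$, and $f:\mathbb{R}^n\to\mathbb{R}^n$, $g:\mathbb{R}^n\to\mathbb{R}^{n\times m}$ locally Lipschitz continuous. Let $\mathcal{C}=\{x\in\mathbb{R}^n : h(x)\ge 0\}$ for a $C^r$ function $h:\mathbb{R}^n\to\mathbb{R}$ ($r\ge 2$) that is a control barrier function with relative degree $r$, i.e. with ${\bf a}=[a_1,\dots,a_r]^\top\in\mathbb{R}^r$ such that $$\sup_{u\in U}\left[L_gL_f^{r-1}h(x)u+L_f^rh(x)+{\bf a}^\top\eta(x)\right]\ge 0\quad\text{for all }x\in\mathbb{R}^n,$$ where $\eta(x)=[L_f^{r-1}h(x),L_f^{r-2}h(x),\dots,h(x)]^\top$ and the roots of $\lambda^r+a_1\lambda^{r-1}+\dots+a_{r-1}\lambda+a_r$ are all negative reals $-\lambda_1,\dots,-\lambda_r<0$. Let $0=t_0<t_1<t_2<\dots$ with $t_k\to\infty$ be the sampling instants, $\Delta_k=t_{k+1}-t_k$, and $x_k=x(t_k)$. For each $k\in\mathbb{Z}_{\ge 0}$ let $\mathcal{Z}_k=\mathcal{R}([t_k,t_k+\Delta_k],x_k)\times U$, let $z_k^*=({x_k^*}^{\top},{u_k^*}^{\top})^{\top}\in\mathcal{Z}_k$ be a given state-input pair, and let $(P_k^N,I_k)$ be the $N$-th order interval Taylor model around $z_k^*$ on $\mathcal{Z}_k$ of $$\Delta\xi(x,u,x_k)=\xi(x,u)-\xi(x_k,u),\qquad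 \xi(x,u)=L_gL_f^{r-1}h(x)u+L_f^rh(x)+{\bf a}^\top\eta(x).$$ Suppose that $\phi(x_k,\Delta_k)=\underline I_k+\phi_k^*$, where $\underline I_k$ is the lower bound of $I_k$ and $\phi_k^*=\min_{z\in\mathcal{Z}_k}P_k^N(z-z_k^* )$, and that the resulting set $$K^s_{\mathrm{zcbf}}(x_k,\Delta_k)=\{u\in U : L_f^rh(x_k)+L_gL_f^{r-1}h(x_k)u+{\bf a}^\top\eta(x_k)+\phi(x_k,\Delta_k)\ge 0\}$$ is non-empty. If $s_j(x(0))\ge 0$ for $j=0,1,\dots,r-1$, where $s_0(x(t))=h(x(t))$ and $s_j(x(t))=\left(\frac{\mathrm{d}}{\mathrm{d}t}+\lambda_j\right)s_{j-1}(x(t))$, then any input $u(t)=u_k$ for $t\in[t_k,t_k+\Delta_k)$ such that $u_k\in K^s_{\mathrm{zcbf}}(x_k,\Delta_k)$ (for every $k$) renders $h(x(t))\ge 0$ for all $t\ge 0$.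
   Context: Lie derivatives: $L_fh(x)=\frac{\partial h}{\partial x}f(x)$, $L_gh(x)=\frac{\partial h}{\partial x}g(x)$, iterated as $L_f^{i}h=L_f(L_f^{i-1}h)$; $f,g$ are regular enough for the Lie derivatives used to be defined. Relative degree $r$ is understood in the standard sense of nonlinear control (in particular $L_gL_f^{i}h\equiv 0$ for $0\le i\le r-2$), so for $1\le j\le r-1$ the functions $s_j$ depend on the state only: $s_j=L_fs_{j-1}+\lambda_js_{j-1}$. $x(t;t_0,x_0)$ (or simply $x(t)$) denotes the solution of the system at time $t$ starting from $x_0$ at time $t_0$ under a given input signal $u(\cdot)$; solutions are assumed to exist for all $t\ge t_0$. Reachable tube: $\mathcal{R}([t_k,t_k+\Delta_k],x_k)$ is the set of all states $x(t;t_k,x_k)$ with $t\in[t_k,t_k+\Delta_k]$, over input signals with values in $U$. Interval Taylor model: for a real-valued function $F$ on a set $S$ that is $(N+1)$ times continuously partially differentiable on an open set containing $S$, and a point $z_0\in S$, an $N$-th order interval Taylor model of $F$ around $z_0$ on $S$ is a pair $(P^N,I)$ where $P^N$ is the $N$-th order Taylor polynomial of $F$ around $z_0$ and $I$ is a real interval such that $F(z)\in P^N(z-z_0)+I$ for all $z\in S$. Here $z=(x^\top,u^\top)^\top$. *)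

(* Defs.v *)
From HB Require Import structures.
From mathcomp Require Import all_boot all_order all_algebra.
From mathcomp Require Import all_classical all_reals all_analysis.

Set Implicit Arguments.
Unset Strict Implicit.
Unset Printing Implicit Defensive.

Import Order.TTheory GRing.Theory Num.Theory.
Import numFieldNormedType.Exports.

Local Open Scope classical_set_scope.
Local Open Scope ring_scope.

Section Calculus.
Context {R : realType}.

Definition locally_lipschitz (V W : normedModType R) (F : V -> W) : Prop :=
  forall x : V, exists2 A, nbhs x A & [lipschitz F y | y in A].

Definition partial (p : nat) (i : 'I_p) (F : 'cV[R]_p -> R) : 'cV[R]_p -> R :=
  fun z => 'D_(delta_mx i 0) F z.

(* [k] times continuously partially differentiable on [O]; meant for open [O],
   since the iterated partial derivatives at points of [O] then depend only on
   the values of [F] on [O]. *)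
Fixpoint Ck (p k : nat) (O : set 'cV[R]_p) (F : 'cV[R]_p -> R) : Prop :=
  (forall z, O z -> {for z, continuous F}) /\
  match k with
  | 0 => True
  | k'.+1 => forall i : 'I_p,
      (forall z, O z -> derivable F z (delta_mx i 0)) /\ Ck k' O (partial i F)
  end.

(* The Taylor polynomial as a function of the increment [d]: the degree-k part
   is  1/k! * sum_(i1,...,ik) d_i1...d_ik F(z0) * d_i1 * ... * d_ik,  the sum
   ranging over all k-tuples of coordinate indices. *)
Definition taylor_poly (p N : nat) (F : 'cV[R]_p -> R) (z0 d : 'cV[R]_p) : R :=
  \sum_(k < N.+1) (k`!%:R)^-1 *
    \sum_(s : k.-tuple 'I_p)
       foldr (@partial p) F s z0 * \prod_(i <- s) d i 0.

Definition interval_taylor_model (p N : nat) (F : 'cV[R]_p -> R)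
    (S : set 'cV[R]_p) (z0 : 'cV[R]_p)
    (P : 'cV[R]_p -> R) (I : interval R) : Prop :=
  [/\ S z0,
      exists O : set 'cV[R]_p, [/\ open O, S `<=` O & Ck N.+1 O F],
      (forall d, P d = taylor_poly N F z0 d) &
      forall z, S z -> exists2 e, e \in I & F z = P (z - z0) + e].

Definition is_min (A : set R) (v : R) : Prop := A v /\ lbound A v.

End Calculus.

Section LieDerivatives.
Context {R : realType} {n m : nat}.
Implicit Types (f : 'cV[R]_n -> 'cV[R]_n) (g : 'cV[R]_n -> 'M[R]_(n, m)).
Implicit Types (h : 'cV[R]_n -> R).

Definition grad h (x : 'cV[R]_n) : 'rV[R]_n := \row_i partial i h x.

Definition lie f h (x : 'cV[R]_n) : R := (grad h x *m f x) 0 0.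

Definition lieg g h (x : 'cV[R]_n) : 'rV[R]_m := grad h x *m g x.

Definition lien (i : nat) f h : 'cV[R]_n -> R := iter i (lie f) h.

Definition relative_degree (r : nat) f g h : Prop :=
  (forall i, (i.+1 < r)%N -> forall x, lieg g (lien i f h) x = 0) /\
  (forall x, lieg g (lien r.-1 f h) x != 0).

Definition eta (r : nat) f h (x : 'cV[R]_n) : 'cV[R]_r :=
  \col_(i < r) lien (r - i.+1) f h x.

Definition xi (r : nat) f g h (a : 'cV[R]_r)
    (x : 'cV[R]_n) (u : 'cV[R]_m) : R :=
  (lieg g (lien r.-1 f h) x *m u) 0 0 + lien r f h x
  + (a^T *m eta r f h x) 0 0.

Definition Delta_xi (r : nat) f g h (a : 'cV[R]_r) (xk : 'cV[R]_n)
    (z : 'cV[R]_(n + m)) : R :=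
  xi f g h a (usubmx z) (dsubmx z) - xi f g h a xk (dsubmx z).

(* Below the relative degree, d/dt along solutions is the Lie derivative along
   [f], so that s_j = (d/dt + lam_j) s_(j-1) is a function of the state. *)
Fixpoint s_fun (lam : nat -> R) f h (j : nat) : 'cV[R]_n -> R :=
  match j with
  | 0 => h
  | j'.+1 => fun x =>
      lie f (s_fun lam f h j') x + lam j'.+1 * s_fun lam f h j' x
  end.

Definition K_zcbf (r : nat) f g h (a : 'cV[R]_r) (U : set 'cV[R]_m)
    (phi : 'cV[R]_n -> R -> R) (x : 'cV[R]_n) (D : R) : set 'cV[R]_m :=
  [set u | U u /\
     0 <= lien r f h x + (lieg g (lien r.-1 f h) x *m u) 0 0
          + (a^T *m eta r f h x) 0 0 + phi x D].

End LieDerivatives.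

Section ControlSystem.
Context {R : realType} {n m : nat}.
Variables (f : 'cV[R]_n -> 'cV[R]_n) (g : 'cV[R]_n -> 'M[R]_(n, m)).
Variable (U : set 'cV[R]_m).

(* Input signals on [t0, +oo[: measurable, bounded on bounded intervals.
   Their values before [t0] are irrelevant. *)
Definition input_signal (t0 : R) (u : R -> 'cV[R]_m) : Prop :=
  [/\ forall t, t0 <= t -> U (u t),
      forall i, measurable_fun `[t0, +oo[ (fun t => u t i 0) &
      forall t1, exists M, forall t, t0 <= t <= t1 -> `|u t| <= M].

(* Solutions in the sense of Caratheodory of x' = f(x) + g(x) u, x(t0) = x0,
   on [t0, +oo[. *)
Definition solution (u : R -> 'cV[R]_m) (t0 : R) (x0 : 'cV[R]_n)
    (x : R -> 'cV[R]_n) : Prop :=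
  {within `[t0, +oo[, continuous x} /\
  forall t, t0 <= t -> forall i : 'I_n,
    let rhs := fun s => (f (x s) + g (x s) *m u s) i 0 in
    (@lebesgue_measure R).-integrable `[t0, t] (EFin \o rhs) /\
    x t i 0 = x0 i 0 + \int[@lebesgue_measure R]_(s in `[t0, t]) rhs s.

Definition forward_complete : Prop :=
  forall t0 x0 u, input_signal t0 u -> exists x, solution u t0 x0 x.

Definition reach_tube (t0 t1 : R) (x0 : 'cV[R]_n) : set 'cV[R]_n :=
  [set y | exists u x, [/\ input_signal t0 u, solution u t0 x0 x &
                           exists2 t, t0 <= t <= t1 & y = x t]].

End ControlSystem.

(* Main.v *)
Require Import Defs.
From HB Require Import structures.
From mathcomp Require Import all_boot all_order all_algebra.
From mathcomp Require Import all_classical all_reals all_analysis.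

Set Implicit Arguments.
Unset Strict Implicit.
Unset Printing Implicit Defensive.

(* Put q_j = prod_(1 <= l <= j) (X + lam_l).  Below the relative degree d/dt acts
   as L_f, hence s_j = q_j(L_f) h and, since q_r = X^r + sum_i a_i X^(r-i-1),
   along a trajectory (d/dt + lam_r) s_(r-1) = xi(x, u) while
   (d/dt + lam_(j+1)) s_j = s_(j+1) for j < r - 1.  On the k-th sampling
   interval (x(t), u_k) stays in Z_k, so the Taylor model bounds
   xi(x(t), u_k) - xi(x_k, u_k) from below by phi, and u_k in K_zcbf gives
   xi(x(t), u_k) >= 0.  Now y' + c y >= 0 and y(0) >= 0 imply y >= 0, which is
   applied to s_(r-1), s_(r-2), ..., s_0 = h in turn. *)

Import Order.TTheory GRing.Theory Num.Theory.
Import numFieldNormedType.Exports.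

Local Open Scope classical_set_scope.
Local Open Scope ring_scope.

(** * Lie derivatives as directional derivatives *)

Section DirectionalDerivatives.
Context {R : realType} {n m : nat}.
Implicit Types (f : 'cV[R]_n -> 'cV[R]_n) (g : 'cV[R]_n -> 'M[R]_(n, m)).
Implicit Types (h : 'cV[R]_n -> R).

(** Differentiability makes the derivative linear in the direction, so [v] can be expanded in the
    canonical basis. *)
Lemma mul_grad_derive h (y v : 'cV[R]_n) : differentiable h y ->
  (grad h y *m v) 0 0 = 'D_v h y.
Proof.
move=> dh; rewrite deriveE// {2}(matrix_sum_delta v) linear_sum mxE.
apply: eq_bigr => i _; rewrite big_ord1 linearZ mxE /partial deriveE//.
by rewrite mulrC.
Qed.

Lemma lie_derive f h y : differentiable h y -> lie f h y = 'D_(f y) h y.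
Proof. exact: mul_grad_derive. Qed.

Lemma lieg_derive g h y u : differentiable h y ->
  (lieg g h y *m u) 0 0 = 'D_(g y *m u) h y.
Proof. by move=> dh; rewrite /lieg -mulmxA mul_grad_derive. Qed.

Lemma differentiable_lincomb k (c : nat -> R) (F : nat -> 'cV[R]_n -> R) y :
  (forall i, (i < k)%N -> differentiable (F i) y) ->
  differentiable (fun w => \sum_(i < k) c i * F i w) y.
Proof.
move=> dF; rewrite (_ : (fun w => _) = \sum_(i < k) (c i *: F i)).
  by apply: differentiable_sum => i; apply: differentiableZ; exact: dF.
by apply/funext => w; rewrite fct_sumE.
Qed.

Lemma derive_lincomb k (c : nat -> R) (F : nat -> 'cV[R]_n -> R) y v :
  (forall i, (i < k)%N -> differentiable (F i) y) ->
  'D_v (fun w => \sum_(i < k) c i * F i w) y = \sum_(i < k) c i * 'D_v (F i) y.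
Proof.
move=> dF; rewrite (_ : (fun w => _) = \sum_(i < k) (c i *: F i)); last first.
  by apply/funext => w; rewrite fct_sumE.
rewrite derive_sum => [|i].
  by apply: eq_bigr => i _; rewrite deriveZ//; apply: diff_derivable; exact: dF.
by apply: derivableZ; apply: diff_derivable; exact: dF.
Qed.

End DirectionalDerivatives.

(** * The functions s_j as polynomials in L_f applied to h *)

Section AuxiliaryOutputs.
Context {R : realType} {n m : nat}.
Variables (f : 'cV[R]_n -> 'cV[R]_n) (g : 'cV[R]_n -> 'M[R]_(n, m)).
Variables (h : 'cV[R]_n -> R) (lam : nat -> R) (r : nat).
Hypothesis dlien :
  forall i, (i < r)%N -> forall y, differentiable (lien i f h) y.

Definition lambda_poly (j : nat) : {poly R} :=
  \prod_(1 <= l < j.+1) ('X - (- lam l)%:P).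

Local Notation q := lambda_poly.

Lemma lambda_polyS j : q j.+1 = q j * ('X - (- lam j.+1)%:P).
Proof. by rewrite /q big_nat_recr. Qed.

Lemma size_lambda_poly j : size (q j) = j.+1.
Proof. by rewrite /q size_prod_XsubC size_iota subn1. Qed.

Lemma lambda_poly_monic j : q j \is monic.
Proof. exact: monic_prod_XsubC. Qed.

(** Multiplying by X + lam_(j+1) mirrors applying L_f + lam_(j+1). The case j = r is included
    because reaching it differentiates only [lien i f h] with i < r. *)
Lemma s_fun_lincomb j : (j <= r)%N ->
  s_fun lam f h j = fun y => \sum_(i < j.+1) (q j)`_i * lien i f h y.
Proof.
elim: j => [|j IH] jr; apply/funext => y.
  by rewrite big_ord1 /q big_geq// coef1 mul1r.
rewrite /= IH ?(ltnW jr)// lie_derive; last first.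
  by apply: differentiable_lincomb => i ij; apply: dlien; exact: leq_trans ij jr.
rewrite derive_lincomb => [|i ij]; last by apply: dlien; exact: leq_trans ij jr.
have qE i : (q j.+1)`_i = (q j * 'X)`_i + lam j.+1 * (q j)`_i.
  by rewrite lambda_polyS polyCN opprK mulrDr coefD coefMC (mulrC (lam _)).
under [RHS]eq_bigr do rewrite qE mulrDl.
rewrite big_split /=; congr (_ + _).
  (* The factor ['X] shifts coefficients up by one, matching the extra L_f; the constant coefficient
     becomes 0. *)
  rewrite [RHS]big_ord_recl coefMX mul0r add0r; apply: eq_bigr => i _.
  rewrite coefMX/= -lie_derive//; apply: dlien.
  exact: leq_trans (ltn_ord i) jr.
(* The sum for j+1 has one more index, where the coefficient of [q j] is the default 0. *)
rewrite [RHS]big_ord_recr /= (nth_default _ (_ : size (q j) <= j.+1)%N).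
  by rewrite mulr0 mul0r addr0 big_distrr /=; apply: eq_bigr => i _; rewrite mulrA.
by rewrite size_lambda_poly.
Qed.

Lemma differentiable_s_fun j y : (j < r)%N -> differentiable (s_fun lam f h j) y.
Proof.
move=> jr; rewrite s_fun_lincomb ?(ltnW jr)//.
by apply: differentiable_lincomb => i ij; apply: dlien; exact: leq_trans ij jr.
Qed.

(** By the relative degree only the top term i = j can survive, and only when j = r - 1; its
    coefficient is 1 since [q j] is monic. *)
Lemma lieg_s_fun j y (u : 'cV[R]_m) : (j < r)%N -> relative_degree r f g h ->
  (lieg g (s_fun lam f h j) y *m u) 0 0 =
  if j == r.-1 then (lieg g (lien r.-1 f h) y *m u) 0 0 else 0.
Proof.
move=> jr [rd _]; rewrite lieg_derive; last exact: differentiable_s_fun.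
rewrite s_fun_lincomb ?(ltnW jr)// derive_lincomb => [|i ij]; last first.
  by apply: dlien; exact: leq_trans ij jr.
have d0 i : (i.+1 < r)%N -> 'D_(g y *m u) (lien i f h) y = 0.
  move=> ir; rewrite -lieg_derive; last by apply: dlien; exact: ltnW.
  by rewrite rd// mul0mx mxE.
rewrite big_ord_recr/= big1 => [|i _]; last first.
  by rewrite d0 ?mulr0//; exact: leq_ltn_trans (ltn_ord i) jr.
have := lambda_poly_monic j; rewrite monicE lead_coefE size_lambda_poly => /eqP ->.
rewrite add0r mul1r; case: ifPn => [/eqP jE|jN].
  by rewrite {1}jE -lieg_derive// -jE; exact: dlien.
apply: d0; rewrite ltn_neqAle jr andbT; apply: contra jN => /eqP <-.
by rewrite /=.
Qed.

Lemma s_fun_eta (a : 'cV[R]_r) y :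
  'X^r + \sum_(i < r) a i 0 *: 'X^(r - i.+1) = q r ->
  s_fun lam f h r y = lien r f h y + (a^T *m Defs.eta r f h y) 0 0.
Proof.
move=> qE; rewrite s_fun_lincomb// -qE.
(* The substitution of L_f for X, checked on monomials; both sides then follow by linearity. *)
have XE e : (e <= r)%N ->
    \sum_(k < r.+1) ('X^e : {poly R})`_k * lien k f h y = lien e f h y.
  rewrite -ltnS => er; rewrite (bigD1 (Ordinal er))//= coefXn eqxx mul1r.
  rewrite big1 ?addr0// => k; rewrite -val_eqE/= coefXn => /negPf ->.
  by rewrite mul0r.
under eq_bigr do rewrite coefD mulrDl coef_sum big_distrl/=.
rewrite big_split/= XE//; congr (_ + _).
rewrite exchange_big/= mxE; apply: eq_bigr => i _; rewrite !mxE.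
under eq_bigr do rewrite coefZ -mulrA.
by rewrite -big_distrr/= XE// leq_subr.
Qed.

End AuxiliaryOutputs.

(** * Continuity of the vector fields and a scalar comparison inequality *)

Lemma locally_lipschitz_continuous (R : realType) (V W : normedModType R)
  (F : V -> W) : locally_lipschitz F -> continuous F.
Proof.
move=> lF y; have [A Ay lA] := lF y.
have [M M0 {}lA] : exists2 M : R, 0 < M &
    forall z, A z -> `|F y - F z| <= M * `|y - z|.
  (* The Lipschitz property holds for all large enough constants, so a positive one can be
     chosen. *)
  have [M [M0 lM]] : exists M : R, 0 < M /\ M.-lipschitz_A F.
    near (pinfty_nbhs R) => M; exists M; split; near: M => //.
    exact: nbhs_pinfty_gt.
  by exists M => // z Az; apply: (lM (y, z)); split => //=; exact: nbhs_singleton.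
apply/cvgrPdist_le => e e0; near=> z.
apply: (le_trans (lA z _)); first by near: z.
rewrite -ler_pdivlMl//; near: z.
by apply: cvgr_dist_le => //; rewrite mulr_gt0// invr_gt0.
Unshelve. all: by end_near. Qed.

(* The weight [expR (c * t)] turns [0 <= y' + c * y] into monotonicity. *)
Lemma ge0_of_linear_differential_inequality (R : realType) (y : R -> R)
  (c a b : R) :
  {within `[a, b], continuous y} ->
  (forall t, t \in `]a, b[ -> derivable y t 1) ->
  (forall t, t \in `]a, b[ -> 0 <= y^`()%classic t + c * y t) ->
  0 <= y a -> forall t, a <= t <= b -> 0 <= y t.
Proof.
move=> cy dy y0 ya t /andP[at_ tb].
pose w s := expR (c * s).
have dw (s : R) : is_derive s (1 : R) w (c * w s).
  have dc : is_derive s (1 : R) (c \*: id) (c *: (1 : R)) by exact: is_deriveZ.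
  have := is_derive1_comp (is_derive_expR (c * s)) dc.
  by rewrite /GRing.scale/= mulr1 mulrC.
have cw : {within `[a, b], continuous w}.
  apply: continuous_subspaceT => s; apply: differentiable_continuous.
  exact/derivable1_diffP.
have dwy (s : R) : s \in `]a, b[ ->
    is_derive s 1 (w * y) (w s * (y^`()%classic s + c * y s)).
  move=> sab; have dys : is_derive s 1 y (y^`()%classic s).
    by rewrite derive1E; apply/derivableP; exact: dy.
  apply: (is_derive_eq (is_deriveM (dw s) dys)).
  rewrite /GRing.scale/= mulrDr; congr (_ + _).
  by rewrite mulrCA [RHS]mulrCA (mulrC (y s)).
have : (w * y) a <= (w * y) t.
  apply: (@ger0_derive1_le_cc _ (w * y) a b) => //.
  - by move=> s sab; have [] := dwy s sab.
  - move=> s sab; rewrite derive1E; have [_ ->] := dwy s sab.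
    by rewrite mulr_ge0 ?expR_ge0// y0.
  - move=> s; apply: (@continuousM _ (subspace `[a, b]) w y s).
      exact: cw.
    exact: cy.
  - by rewrite in_itv/= lexx (le_trans at_ tb).
  - by rewrite in_itv/= at_ tb.
move=> wy; have : 0 <= (w * y) t.
  by apply: le_trans wy; rewrite mulr_ge0// expR_ge0.
by rewrite pmulr_rge0// expR_gt0.
Qed.

(** * Restarting and differentiating Caratheodory solutions *)

Section Trajectories.
Context {R : realType} {n m : nat}.
Variables (f : 'cV[R]_n -> 'cV[R]_n) (g : 'cV[R]_n -> 'M[R]_(n, m)).
Hypotheses (cf : continuous f) (cg : continuous g).
Variables (u : R -> 'cV[R]_m) (t0 : R) (x0 : 'cV[R]_n) (x : R -> 'cV[R]_n).
Hypothesis sol : solution f g u t0 x0 x.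

Lemma solution_restart t1 : t0 <= t1 -> solution f g u t1 (x t1) x.
Proof.
move=> t01; have [cx ix] := sol; split.
  apply: continuous_subspaceW cx => t /=; rewrite !in_itv/= !andbT.
  exact: le_trans.
move=> t t1t i /=; have [it xt] := ix t (le_trans t01 t1t) i.
have [_ ->] := ix t1 t01 i; split.
  apply: integrableS it => //; apply: subset_itvr; rewrite bnd_simp//.
rewrite xt -addrA; congr (_ + _).
rewrite -[X in _ = _ + X]Rintegral_itv_obnd_cbnd; last first.
  by apply: integrableS it => //; apply: subset_itvr; rewrite bnd_simp.
by rewrite -(Rintegral_itvB (x := t1) it) ?bnd_simp// addrC subrK.
Qed.

(** Where the input is constant the integrand is continuous, so the fundamental theorem of calculus
    turns the integral equation into a classical derivative. *)
Lemma solution_derivative a b v t : t0 <= a ->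
  (forall s, a <= s < b -> u s = v) -> a < t < b ->
  is_derive t 1 x (f (x t) + g (x t) *m v).
Proof.
move=> t0a uv /andP[at_ tb]; have [cx ix] := sol.
have t0t : t0 < t by exact: le_lt_trans at_.
have t0b : t0 <= b by rewrite (le_trans (ltW t0t))// ltW.
have near_ab : \forall s \near t, a < s < b.
  near=> s; apply/andP; split; near: s.
    exact: lt_nbhsr.
  exact: lt_nbhsl.
have cxt : {for t, continuous x}.
  (* Passing to an open half-line containing [t] turns relative continuity into continuity at
     [t]. *)
  have : {within `]t0, +oo[, continuous x}.
    by apply: continuous_subspaceW cx => s /=; rewrite !in_itv/= !andbT => /ltW.
  rewrite continuous_open_subspace; last exact: interval_open.
  by apply; rewrite inE/= in_itv/= t0t.
have cfx : {for t, continuous (f \o x)} := continuous_comp cxt (@cf (x t)).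
have cgx : {for t, continuous (g \o x)} := continuous_comp cxt (@cg (x t)).
have dxi i : is_derive t 1 (fun s => x s i 0) ((f (x t) + g (x t) *m v) i 0).
  pose rhs := fun s => (f (x s) + g (x s) *m u s) i 0.
  have [ib _] := ix b t0b i.
  have rhsE : \forall s \near t,
      (f (x s)) i 0 + \sum_j g (x s) i j * v j 0 = rhs s.
    near=> s; have /andP[as_ sb] : a < s < b by near: s.
    by rewrite /rhs !mxE uv ?(ltW as_).
  have crhs : {for t, continuous rhs}.
    rewrite /prop_for /continuous_at -(nbhs_singleton rhsE).
    apply: cvg_trans (near_eq_cvg rhsE) _; apply: cvgD.
      exact: (continuous_comp cfx (@coord_continuous _ _ _ i 0 _)).
    apply: (@cvg_big R _ +%R 0 xpredT _ R (nbhs t) (index_enum 'I_m)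
      (fun j s => g (x s) i j * v j 0) (fun j => g (x t) i j * v j 0))
      => [|j _]; first exact: add_continuous.
    apply: cvgMl.
    exact: (continuous_comp cgx (@coord_continuous _ _ _ i j _)).
  have [dF F'] := continuous_FTC1_closed tb ib t0t crhs.
  have dFt : is_derive t 1 (fun s => \int[lebesgue_measure]_(z in `[t0, s]) rhs z) (rhs t).
    by apply: DeriveDef; [exact: dF|rewrite -derive1E; exact: F'].
  have -> : (f (x t) + g (x t) *m v) i 0 = rhs t.
    by rewrite /rhs uv// (ltW at_).
  have := is_deriveD (is_derive_cst (x0 i 0) t (1 : R)) dFt; rewrite add0r.
  apply: near_eq_is_derive; near=> s.
  have t0s : t0 <= s by apply/ltW; near: s; exact: lt_nbhsr.
  by have [_ ->] := ix s t0s i.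
have dx : derivable x t 1.
  by apply/derivable_mxP => i j; rewrite ord1; have [] := dxi i.
apply: DeriveDef => //; rewrite derive_mx//; apply/matrixP => i j.
by rewrite mxE ord1; have [_ ->] := dxi i.
Unshelve. all: by end_near. Qed.

End Trajectories.

Lemma is_derive_along (R : realType) (n : nat) (h : 'cV[R]_n -> R)
  (x : R -> 'cV[R]_n) (t : R) (v : 'cV[R]_n) :
  differentiable h (x t) -> is_derive t (1 : R) x v ->
  is_derive t (1 : R) (h \o x) ('D_v h (x t)).
Proof.
move=> dh [dx dxE].
have dx' : differentiable x t by exact/derivable1_diffP.
apply: DeriveDef; first exact/derivable1_diffP/differentiable_comp.
rewrite deriveE; last exact: differentiable_comp.
by rewrite diff_comp//= -(deriveE _ dx') dxE deriveE.
Qed.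

(** * Sampling instants and sampled inputs *)

Section Sampling.
Context {R : realType}.
Variable ts : nat -> R.
Hypotheses (ts_lt : forall k, ts k < ts k.+1).
Hypothesis (ts_oo : ts k @[k --> \oo] --> +oo).

Lemma sampling_le j k : (j <= k)%N -> ts j <= ts k.
Proof.
move=> /subnK <-; elim: (k - j)%N => [//|l IH].
by rewrite (le_trans IH)// addSn ltW.
Qed.

Lemma sampling_unbounded t : exists k, t < ts k.
Proof.
have /cvgryPgt/(_ t)[k _ tk] := ts_oo.
by exists k; apply: tk => /=.
Qed.

Lemma sampling_locate k0 t : ts k0 <= t ->
  exists2 k, (k0 <= k)%N & ts k <= t < ts k.+1.
Proof.
(* The interval containing [t] ends at the first sampling instant beyond [t]. *)
move=> t0; have [K] := ex_minnP (sampling_unbounded t).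
case: K => [|K] tK Kmin.
  by move: tK; rewrite ltNge (le_trans _ t0)// sampling_le.
exists K; last by rewrite tK andbT leNgt; apply/negP => /Kmin; rewrite ltnn.
rewrite leqNgt; apply/negP => /sampling_le.
by rewrite leNgt (le_lt_trans t0).
Qed.

(** This admissibility places the closed-loop trajectory in the reachable tube started at any
    sampling instant. *)
Lemma sampled_input_signal (m : nat) (U : set 'cV[R]_m) (u : R -> 'cV[R]_m)
  (uk : nat -> 'cV[R]_m) k0 :
  (forall k, U (uk k)) -> (forall k t, ts k <= t < ts k.+1 -> u t = uk k) ->
  input_signal U (ts k0) u.
Proof.
move=> Uk uE; split.
- by move=> t /sampling_locate[k _ /uE ->].
- move=> i.
  have -> : (`[ts k0, +oo[ = \bigcup_k `[ts (k0 + k)%N, ts (k0 + k).+1[)%classic.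
    apply/seteqP; split => t /=.
      rewrite in_itv/= andbT => /sampling_locate[k k0k tk].
      by exists (k - k0)%N => //=; rewrite subnKC// in_itv.
    move=> [k _] /=; rewrite !in_itv/= andbT => /andP[+ _].
    by apply: le_trans; rewrite sampling_le// leq_addr.
  apply/measurable_fun_bigcup => [k|k]; first exact: measurable_itv.
  apply: (eq_measurable_fun (cst (uk (k0 + k)%N i 0))).
    by move=> t; rewrite inE/= in_itv/= => /uE ->.
  exact: measurable_cst.
- move=> t1; have [K tK] := sampling_unbounded t1.
  (* Up to [t1] only inputs of index below [K] occur; the sum of their norms dominates each one. *)
  exists (\sum_(k < K) `|uk k|) => t /andP[/sampling_locate[k _ /andP[tk tk']] tt1].
  have kK : (k < K)%N.
    rewrite ltnNge; apply/negP => /sampling_le Kk.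
    by have := lt_le_trans tK Kk; rewrite ltNge (le_trans tk).
  rewrite (uE k) ?tk// (bigD1 (Ordinal kK))//= lerDl.
  by apply: sumr_ge0 => j _; exact: normr_ge0.
Qed.

(** No derivative is assumed at the sampling instants, so the comparison is applied interval by
    interval, the sign at each endpoint starting the next interval. *)
Lemma sampled_linear_differential_inequality (y : R -> R) (c : R) :
  {within `[ts 0%N, +oo[, continuous y} ->
  (forall k t, ts k < t < ts k.+1 ->
     exists2 dy : R, is_derive t (1 : R) y dy & 0 <= dy + c * y t) ->
  0 <= y (ts 0%N) -> forall t, ts 0%N <= t -> 0 <= y t.
Proof.
move=> cy dy y0.
have step k : 0 <= y (ts k) -> forall t, ts k <= t <= ts k.+1 -> 0 <= y t.
  apply: (ge0_of_linear_differential_inequality (c := c)).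
  - apply: continuous_subspaceW cy => t /=; rewrite !in_itv/= andbT => /andP[+ _].
    by apply: le_trans; exact: sampling_le.
  - by move=> t; rewrite in_itv/= => /dy[d []].
  - by move=> t; rewrite in_itv/= => /dy[d [_ <-]]; rewrite derive1E.
have ytk k : 0 <= y (ts k).
  by elim: k => // k /step; apply; rewrite lexx ltW.
move=> t /sampling_locate[k _ /andP[tk tk']].
by apply: (step k) => //; rewrite tk ltW.
Qed.

End Sampling.

(** * The lower bound on [xi] supplied by the Taylor model *)

Lemma xi_ge0_on_reach (R : realType) (n m r N : nat)
  (f : 'cV[R]_n -> 'cV[R]_n) (g : 'cV[R]_n -> 'M[R]_(n, m))
  (U : set 'cV[R]_m) (h : 'cV[R]_n -> R) (a : 'cV[R]_r)
  (phi : 'cV[R]_n -> R -> R) (S : set 'cV[R]_n) (xk : 'cV[R]_n) (D : R)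
  (z0 : 'cV[R]_(n + m)) (P : 'cV[R]_(n + m) -> R) (I : interval R)
  (pmin : R) (v : 'cV[R]_m) :
  let Z := [set z : 'cV[R]_(n + m) | S (usubmx z) /\ U (dsubmx z)] in
  interval_taylor_model N (Delta_xi f g h a xk) Z z0 P I ->
  is_min [set P (z - z0) | z in Z] pmin ->
  ((phi xk D)%:E = ereal_inf [set e%:E | e in [set` I]] + pmin%:E)%E ->
  K_zcbf f g h a U phi xk D v ->
  forall y, S y -> 0 <= xi f g h a y v.
Proof.
move=> Z [_ _ _ tm] [_ lbP] phiE [Uv Kv] y Sy.
have Zz : Z (col_mx y v) by rewrite /Z/= col_mxKu col_mxKd.
have [e eI] := tm _ Zz; rewrite /Delta_xi col_mxKu col_mxKd => xiE.
have Pz : pmin <= P (col_mx y v - z0) by apply: lbP; exists (col_mx y v).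
have inf_e : (ereal_inf [set e%:E | e in [set` I]] <= e%:E)%E.
  by apply: ereal_inf_lbound; exists e.
(* Comparing in the extended reals avoids a separate proof that the infimum of [I] is finite. *)
have phi_le : phi xk D <= e + pmin by rewrite -lee_fin phiE EFinD leeD2r.
have -> : xi f g h a y v = xi f g h a xk v + (P (col_mx y v - z0) + e).
  by rewrite -xiE addrC subrK.
apply: (le_trans Kv); rewrite /xi [X in X + _ + _ <= _]addrC lerD2l.
by apply: (le_trans phi_le); rewrite addrC lerD2r.
Qed.

(** * Propagation of nonnegativity from s_(r-1) down to h *)

Theorem proposition2 (R : realType) (n m r N : nat)
  (f : 'cV[R]_n -> 'cV[R]_n) (g : 'cV[R]_n -> 'M[R]_(n, m))
  (U : set 'cV[R]_m) (h : 'cV[R]_n -> R)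
  (a : 'cV[R]_r) (lam : nat -> R)
  (* sampling instants, closed-loop trajectory and its input *)
  (ts : nat -> R) (x : R -> 'cV[R]_n) (u : R -> 'cV[R]_m)
  (uk : nat -> 'cV[R]_m)
  (* interval Taylor models *)
  (zstar : nat -> 'cV[R]_(n + m)) (P : nat -> 'cV[R]_(n + m) -> R)
  (I : nat -> interval R) (phi : 'cV[R]_n -> R -> R) (phistar : nat -> R) :
  let Delta := fun k => ts k.+1 - ts k in
  let Z := fun k => [set z : 'cV[R]_(n + m) |
             reach_tube f g U (ts k) (ts k + Delta k) (x (ts k)) (usubmx z) /\
             U (dsubmx z)] in
  (* the system *)
  locally_lipschitz f -> locally_lipschitz g ->
  forward_complete f g U ->
  (* h is a control barrier function with relative degree r *)
  (2 <= r)%N -> Ck r setT h ->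
  (forall i, (i < r)%N -> forall y, differentiable (lien i f h) y) ->
  relative_degree r f g h ->
  (forall y, (0 <= ereal_sup [set (xi f g h a y v)%:E | v in U])%E) ->
  (forall j, (1 <= j <= r)%N -> 0 < lam j) ->
  'X^r + \sum_(i < r) a i 0 *: 'X^(r - i.+1)
    = \prod_(1 <= j < r.+1) ('X - (- lam j)%:P) ->
  (* sampling *)
  ts 0%N = 0 -> (forall k, ts k < ts k.+1) -> ts k @[k --> \oo] --> +oo ->
  (* margin obtained from the interval Taylor models *)
  (forall k, interval_taylor_model N (Delta_xi f g h a (x (ts k)))
               (Z k) (zstar k) (P k) (I k)) ->
  (forall k, is_min [set P k (z - zstar k) | z in Z k] (phistar k)) ->
  (forall k, (phi (x (ts k)) (Delta k))%:E
             = (ereal_inf [set e%:E | e in [set` I k]] + (phistar k)%:E)%E) ->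
  (forall k, K_zcbf f g h a U phi (x (ts k)) (Delta k) !=set0) ->
  (* initial condition *)
  (forall j, (j < r)%N -> 0 <= s_fun lam f h j (x 0)) ->
  (* sampled-data input, and x is the resulting trajectory *)
  (forall k, K_zcbf f g h a U phi (x (ts k)) (Delta k) (uk k)) ->
  (forall k t, ts k <= t < ts k.+1 -> u t = uk k) ->
  solution f g u 0 (x 0) x ->
  forall t, 0 <= t -> 0 <= h (x t).
Proof.
move=> Delta Z lf lg _ r2 _ dlien rd _ _ qE t0 tlt too tm Pmin phiE _ s0 Kuk uE sol.
have Uk k : U (uk k) by have [] := Kuk k.
have ts_ge0 k : 0 <= ts k by rewrite -t0 sampling_le.
have xi_ge0 k t : ts k < t < ts k.+1 -> 0 <= xi f g h a (x t) (uk k).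
  move=> /andP[tk tk'].
  apply: (xi_ge0_on_reach (tm k) (Pmin k) (phiE k) (Kuk k)).
  (* The closed-loop pair itself, restarted at [ts k], witnesses membership in the tube. *)
  exists u, x; split.
  - exact: sampled_input_signal Uk uE.
  - exact: (solution_restart sol (ts_ge0 k)).
  - by exists t => //; rewrite /Delta subrKC !ltW.
have dx k t : ts k < t < ts k.+1 ->
    is_derive t (1 : R) x (f (x t) + g (x t) *m uk k).
  move=> tk; apply: (solution_derivative _ _ sol (ts_ge0 k)) tk.
  - exact: locally_lipschitz_continuous.
  - exact: locally_lipschitz_continuous.
  - by move=> s; exact: uE.
pose s_ := s_fun lam f h.
have ds j y : (j < r)%N -> differentiable (s_ j) y.
  exact: (differentiable_s_fun lam dlien).
(* The chain rule splits the derivative into a drift part and an input part. *)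
have dsx j k t : (j < r)%N -> ts k < t < ts k.+1 ->
    is_derive t (1 : R) (s_ j \o x)
      (lie f (s_ j) (x t) + (lieg g (s_ j) (x t) *m uk k) 0 0).
  move=> jr tk; apply: (is_derive_eq (is_derive_along (ds _ _ jr) (dx _ _ tk))).
  by rewrite -[LHS](mul_grad_derive _ (ds _ _ jr)) mulmxDr mxE /lieg -mulmxA.
have cs j : (j < r)%N -> {within `[ts 0%N, +oo[, continuous (s_ j \o x)}.
  move=> jr t; rewrite t0; have [cx _] := sol.
  by apply: (continuous_comp (cx t)); exact/differentiable_continuous/ds.
have propagate j : (j < r)%N ->
    (forall k t, ts k < t < ts k.+1 -> 0 <= s_ j.+1 (x t) +
       (lieg g (s_ j) (x t) *m uk k) 0 0) ->
    forall t, 0 <= t -> 0 <= s_ j (x t).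
  move=> jr sS.
  have := sampled_linear_differential_inequality tlt too (c := lam j.+1) (cs _ jr).
  rewrite t0; apply => [k t tk|]; last exact: s0.
  eexists; first exact: dsx jr tk.
  by rewrite addrAC; exact: sS.
(* Downward induction on j, written as induction on i = r - 1 - j. *)
have s_ge0 i j : (i + j).+1 = r -> forall t, 0 <= t -> 0 <= s_ j (x t).
  elim: i j => [|i IH] j ijr.
    have jr : (j < r)%N by rewrite -ijr.
    apply: propagate => // k t tk; rewrite (lieg_s_fun lam dlien _ _ jr rd).
    have -> : j == r.-1 by rewrite -ijr.
    (* At j = r - 1 the drift part s_r and the input part add up to [xi]. *)
    rewrite (_ : j.+1 = r)// /s_ (s_fun_eta dlien _ qE) addrAC.
    by have := xi_ge0 k t tk; rewrite /xi [X in X + _]addrC.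
  have jr : (j.+1 < r)%N by rewrite -ijr addSn !ltnS leq_addl.
  apply: propagate => [|k t tk]; first exact: ltnW.
  (* Below r - 1 the input part vanishes, leaving s_(j+1), nonnegative by induction. *)
  rewrite (lieg_s_fun lam dlien _ _ (ltnW jr) rd) ifF.
    rewrite addr0; apply: IH; first by rewrite addnS -addSn.
    by have /andP[/ltW tk' _] := tk; exact: le_trans tk'.
  by apply: ltn_eqF; rewrite -ltnS prednK// (ltn_trans _ jr).
by move=> t t_ge0; apply: (s_ge0 r.-1 0%N) t_ge0; rewrite addn0 prednK// ltnW.
Qed.
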